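(* Let $G$ be a group and let $A$ be a finite-dimensional vector space over a field $K$. Let $\Sigma \subset A^G$ be a linear-sofic subshift (e.g., a linear subshift of finite type) and let $\tau \colon \Sigma \to \Sigma$ be a linear cellular automaton, with limit set $\Omega(\tau) = \bigcap_{n \geq 1} \tau^n(\Sigma)$. Then the following hold: (i) $\Omega(\tau)$ is a linear subshift of $A^G$; (ii) $\tau(\Omega(\tau)) = \Omega(\tau)$; (iii) $\mathrm{Per}(\tau) \subset \mathrm{R}(\tau) \subset \mathrm{NW}(\tau) \subset \mathrm{CR}(\tau) \subset \Omega(\tau)$; (iv) if $\Omega(\tau)$ is of finite type then $\tau$ is stable; (v) if $\Omega(\tau)$ is finite-dimensional then $\tau$ is stable.
   Context: For a $K$-vector space $A$, $A^G$ is the $K$-vector space of all maps $x \colon G \to A$, equipped with the prodiscrete uniform structure (product of the discrete uniform structures; a base of entourages is given by the sets $\{(x,y) : x|_F = y|_F\}$, $F \subset G$ finite) and the associated topology, and with the shift action of $G$ given by $(gx)(h) = x(g^{-1}h)$. A linear subshift of $A^G$ is a closed $G$-invariant vector subspace of $A^G$; it carries the induced uniform structure. It is of finite type (a linear SFT) if it equals $\{x \in A^G : (g^{-1}x)|_D \in P \text{ for all } g \in G\}$ for some finite $D \subset G$ and some $P \subset A^D$. For $K$-vector spaces $A, B$, a linear cellular automaton $B^G \to A^G$ is a map $\tilde\tau$ for which there exist a finite subset $M \subset G$ and a $K$-linear map $\mu \colon B^M \to A$ with $\tilde\tau(x)(g) = \mu((g^{-1}x)|_M)$ for all $x \in B^G$,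 $g \in G$. A linear cellular automaton $\tau \colon \Sigma \to \Sigma$ is a map that is the restriction of a linear cellular automaton $A^G \to A^G$. A linear subshift $\Sigma \subset A^G$ is linear-sofic if there exist a $K$-vector space $B$, a linear SFT $\Sigma' \subset B^G$, and a linear cellular automaton $\sigma \colon B^G \to A^G$ with $\sigma(\Sigma') = \Sigma$. For a map $f \colon X \to X$: $f$ is stable if $f^{n+1}(X) = f^n(X)$ for some $n \geq 1$; $\mathrm{Per}(f) = \bigcup_{n \geq 1}\{x \in X : f^n(x) = x\}$. If $X$ is a topological space and $f$ is continuous, $\mathrm{R}(f)$ (recurrent points) is the set of $x$ such that for every neighborhood $U$ of $x$ there is $n \geq 1$ with $f^n(x) \in U$, and $\mathrm{NW}(f)$ (non-wandering points) is the set of $x$ such that for every neighborhood $U$ of $x$ there is $n \geq 1$ with $f^n(U) \cap U \neq \varnothing$. If $X$ is a uniform space and $f$ is uniformly continuous, $\mathrm{CR}(f)$ (chain-recurrent points) is the set of $x$ such that for every entourage $E$ there exist $n \geq 1$ and $x_0, \dots, x_n \in X$ with $x = x_0 = x_n$ and $(f(x_i), x_{i+1}) \in E$ for all $0 \leq i \leq n-1$. *)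

(* Defs.v *)
From HB Require Import structures.
From mathcomp Require Import all_boot all_order all_algebra.
From mathcomp Require Import all_classical all_reals topology.

Set Implicit Arguments.
Unset Strict Implicit.
Unset Printing Implicit Defensive.

Import GRing.Theory.
Local Open Scope classical_set_scope.
Local Open Scope ring_scope.

(* A^G, with the pointwise vector space structure and the prodiscrete uniform
   structure. A subset of it, seen as a type through [set_type], carries the
   induced uniform structure. *)
Definition config (G A : Type) : Type := G -> A.

HB.instance Definition _ (G : Type) (A : choiceType) :=
  Uniform.copy (config G A) {ptws G -> discrete_topology A}.
HB.instance Definition _ (G : Type) (K : pzRingType) (A : lmodType K) :=
  GRing.Lmodule.copy (config G A) (G -> A).

Section Configurations.
Variables (G : groupType) (K : fieldType).
Implicit Types (A B V : lmodType K).

Definition shift A (g : G) (x : config G A) : config G A :=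
  fun h => x (g^-1 * h)%g.

Definition restr A (D : set G) (x : config G A) : D -> A :=
  fun h => x (set_val h).

Definition linear_subshift A (Sigma : set (config G A)) : Prop :=
  [/\ closed Sigma,
      forall g x, Sigma x -> Sigma (shift g x) &
      GRing.submod_closed [in Sigma]].

Definition linear_SFT A (Sigma : set (config G A)) : Prop :=
  linear_subshift Sigma /\
  exists D : set G, finite_set D /\
    exists P : set (D -> A),
      Sigma = [set x | forall g : G, P (restr (shift g^-1%g x))].

Definition linear_CA B A (t : config G B -> config G A) : Prop :=
  exists M : set G, finite_set M /\
    exists mu : {linear (M -> B) -> A},
      forall x g, t x g = mu (restr (shift g^-1%g x)).

Definition linear_CA_on A (Sigma : set (config G A)) (tau : Sigma -> Sigma) :
    Prop :=
  exists2 t : config G A -> config G A, linear_CA t &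
    forall x : Sigma, set_val (tau x) = t (set_val x).

Definition linear_sofic A (Sigma : set (config G A)) : Prop :=
  linear_subshift Sigma /\
  exists (B : lmodType K) (Sigma' : set (config G B))
         (sigma : config G B -> config G A),
    [/\ linear_SFT Sigma', linear_CA sigma & sigma @` Sigma' = Sigma].

Definition finite_dimensional V (W : set V) : Prop :=
  exists n (b : 'I_n -> V),
    W = range (fun c : 'I_n -> K => \sum_(i < n) c i *: b i).

End Configurations.

Definition limit_set (X : Type) (f : X -> X) : set X :=
  \bigcap_(n in [set n | (1 <= n)%N]) range (iter n f).

Definition stable (X : Type) (f : X -> X) : Prop :=
  exists2 n, (1 <= n)%N & range (iter n.+1 f) = range (iter n f).

Definition Per (X : Type) (f : X -> X) : set X :=
  \bigcup_(n in [set n | (1 <= n)%N]) [set x | iter n f x = x].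

Definition recurrent (X : topologicalType) (f : X -> X) : set X :=
  [set x | forall U, nbhs x U -> exists2 n, (1 <= n)%N & U (iter n f x)].

Definition nonwandering (X : topologicalType) (f : X -> X) : set X :=
  [set x | forall U, nbhs x U ->
     exists2 n, (1 <= n)%N & (iter n f @` U) `&` U !=set0].

Definition chain_recurrent (X : uniformType) (f : X -> X) : set X :=
  [set x | forall E, entourage E ->
     exists n (c : nat -> X), [/\ (1 <= n)%N, c 0%N = x, c n = x &
       forall i, (i < n)%N -> E (f (c i), c i.+1)]].

(* Main.v *)
(* Since [A] is finite-dimensional, [A^G] is linearly compact: a downward
   directed family of nonempty closed affine subspaces has a common point.
   Hence images of closed subspaces under linear cellular automata are closed,
   and such images commute with decreasing intersections; this gives (i) and
   (ii). Chain-recurrent points are limits of points of each [tau^n(Sigma)], so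
   (iii) follows from closedness. For a linear map [f] from [A^G] to a
   finite-dimensional space depending on finitely many coordinates, the
   decreasing sequence of subspaces [f(tau^n(Sigma))] is stationary, with value
   [f(Omega)]. Taking for [f] the restriction to a defining window of [Omega]
   proves (iv). For (v), surjectivity of [tau] on the finite-dimensional [Omega]
   yields a polynomial [q] with [q(0) = 1] and [q(tau) = 0] on [Omega]; taking
   [f x = q(tau)(x)(1)] one gets [q(tau) tau^n = 0] on [Sigma] for some [n],
   that is, [tau^n] is a combination of higher powers of [tau]. *)
From HB Require Import structures.
Require Import Defs.
From mathcomp Require Import all_boot all_order all_algebra finmap.
From mathcomp Require Import all_classical all_reals topology.

Set Implicit Arguments.
Unset Strict Implicit.
Unset Printing Implicit Defensive.

Import GRing.Theory.
Local Open Scope classical_set_scope.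
Local Open Scope ring_scope.

(** * The prodiscrete uniform structure *)

Definition agree (G : eqType) (A : Type) (s : seq G) (x y : config G A) :=
  {in s, x =1 y}.

Lemma config_entourageP (G : eqType) (A : choiceType)
    (E : set (config G A * config G A)) :
  entourage E <->
  exists s : seq G, [set p | agree s p.1 p.2] `<=` E.
Proof.
split=> [[_ [F _ <-] FE]|[s sE]].
  (* The window collects the coordinates of the finitely many subbasic entourages in [F]. *)
  exists [seq ((sval p).1 : G) | p <- finmap.enum_fset F] => -[x y] /= xy.
  apply: FE => -[[g U] gU] pF.
  have [/= V + VU] := asboolW gU.
  rewrite uniform_discrete /discrete_ent => VV.
  apply/VU/VV; exists (x g) => //; congr pair; apply: xy.
  (* [F] lives over [{classic G}], whose boolean equality is not that of [G]. *)
  have /(nthP (exist _ (g, U) gU))[i iF Fi] := pF.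
  apply/(nthP (g : G)); exists i; first by rewrite size_map.
  by rewrite (nth_map (exist _ (g, U) gU)) // Fi.
apply: (filterS sE).
(* Agreement on a window is a finite intersection of agreements at one coordinate, each a subbasic
   entourage. *)
elim: s {sE} => [|g s IHs]; first by apply: filterS filterT => p _ h.
pose U := [set p : config G A * config G A | p.1 g = p.2 g].
have Eg : entourage U.
  pose ent (p : {classic G} * set (config G A * config G A)) :=
    `[< @entourage (initial_topology
          (@proj _ (fun _ : G => discrete_topology A) p.1)) p.2 >].
  have entU : ent (g, U).
    apply/asboolP; exists [set p | p.1 = p.2] => //.
    by rewrite uniform_discrete => _ [a _ <-].
  exists U => //; exists [fset (exist ent (g, U) entU)]%fset.
    by move=> p _; rewrite in_setT.
  by rewrite set_fset1 bigcap_set1.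
apply: filterS (filterI Eg IHs) => p [/= pg ps] h.
by rewrite inE => /predU1P[->//|]; exact: ps.
Qed.

Lemma set_type_entourageP (G : eqType) (A : choiceType)
    (S : set (config G A)) (E : set (S * S)) :
  entourage E <->
  exists s : seq G, [set p | agree s (set_val p.1) (set_val p.2)] `<=` E.
Proof.
split=> [[V /config_entourageP[s sV] VE]|[s sE]].
  by exists s => p ps; apply: VE; exact: sV.
exists [set p | agree s p.1 p.2]; first by apply/config_entourageP; exists s.
by move=> p ps; exact: sE.
Qed.

Lemma closed_configP (G : eqType) (A : choiceType) (S : set (config G A)) :
  closed S <->
  forall x, (forall s : seq G, exists2 y, S y & agree s x y) -> S x.
Proof.
split=> [cS x Sx|cS x Sx].
  apply: cS => U /nbhsP[E /config_entourageP[s sE] EU].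
  have [y Sy xy] := Sx s; exists y; split=> //.
  by apply/EU/xsectionP/sE.
apply: cS => s.
have /Sx[y [Sy /xsectionP xy]] :
    nbhs x (xsection [set p : config G A * config G A | agree s p.1 p.2] x).
  by apply/nbhs_entourage/config_entourageP; exists s.
by exists y.
Qed.

(** * Linear compactness *)

(** A ternary condition, since over the field with two elements affine combinations of two points
    give nothing new. The empty set qualifies. *)
Definition affine (K : fieldType) (V : lmodType K) (S : set V) :=
  forall (k : K) x y z, S x -> S y -> S z -> S (k *: (x - y) + z).

Definition directed (I T : Type) (D : set I) (S : I -> set T) :=
  forall i j, D i -> D j -> exists2 k, D k & S k `<=` S i `&` S j.

(** Take [U] of maximal dimension with [U + a] inside [S]: a point [x] of [S] outside [U + a] would
    allow adding the line of [x - a] to [U]. *)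
Lemma affine_coset (K : fieldType) (V : vectType K) (S : set V) (a : V) :
  affine S -> S a -> exists U : {vspace V}, S = [set x | x - a \in U].
Proof.
move=> affS Sa.
pose P d := `[< exists U : {vspace V},
  \dim U = d /\ forall u, u \in U -> S (u + a) >].
have P0 : exists d, P d.
  exists 0; apply/asboolP; exists 0%VS; rewrite dimv0; split=> // u.
  by rewrite memv0 => /eqP->; rewrite add0r.
have Pmax d : P d -> (d <= \dim {:V})%N.
  by move=> /asboolP[U [<- _]]; exact/dimvS/subvf.
have [d /asboolP[U [dU US]] maxd] := ex_maxnP P0 Pmax.
exists U; apply/seteqP; split=> x /=; last by move=> /US; rewrite subrK.
move=> Sx; apply: contrapT => /negP nUx.
suff /maxd : P (\dim (U + <[x - a]>)).
  rewrite leqNgt -dU ltn_neqAle dimvS ?addvSl// andbT.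
  rewrite (dimv_leqif_eq (addvSl _ _)) => /negP; apply; apply/eqP => UE.
  by move: nUx; rewrite UE (subvP (addvSr _ _)) ?memv_line.
apply/asboolP; eexists; split=> // _ /memv_addP[u uU [_ /vlineP[k ->] ->]].
by rewrite addrC addrA addrC; apply: affS => //; rewrite addrC; exact: US.
Qed.

(** A member of least dimension works: a common lower bound with any [S j] is a coset inside it of
    no smaller dimension, hence equal to it. *)
Lemma affine_least (K : fieldType) (V : vectType K) I (D : set I)
    (S : I -> set V) :
  D !=set0 -> directed D S ->
  (forall i, D i -> affine (S i) /\ S i !=set0) ->
  exists2 i, D i & forall j, D j -> S i `<=` S j.
Proof.
move=> [i0 Di0] dirS affS.
pose P d := `[< exists i a (U : {vspace V}),
  [/\ D i, S i = [set x | x - a \in U] & \dim U = d] >].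
have P0 : exists d, P d.
  have [affi0 [a Sa]] := affS _ Di0; have [U SU] := affine_coset affi0 Sa.
  by exists (\dim U); apply/asboolP; exists i0, a, U.
have [d /asboolP[i [a [U [Di SiU dU]]]] mind] := ex_minnP P0.
exists i => // j Dj; have [k Dk Sk] := dirS _ _ Di Dj.
apply: subset_trans (fun x Skx => (Sk x Skx).2).
have [affk [b Sb]] := affS _ Dk; have [W SkW] := affine_coset affk Sb.
have baU : b - a \in U by have [+ _] := Sk b Sb; rewrite SiU.
have WU : (W <= U)%VS.
  apply/subvP => w wW; have : S k (w + b) by rewrite SkW /= addrK.
  by move=> /Sk[+ _]; rewrite SiU /= -addrA rpredDr.
have UW : U = W.
  apply/esym/eqP; rewrite -(dimv_leqif_eq WU) eqn_leq dimvS// dU.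
  by apply: mind; apply/asboolP; exists k, b, W.
move=> x; rewrite SiU SkW -UW /= => xaU.
by have := rpredB xaU baU; rewrite opprB addrA subrK.
Qed.

Definition affine_based (K : fieldType) (V : lmodType K) (F : set_system V) :=
  forall U, F U -> exists W, [/\ F W, affine W & W `<=` U].

(** An analogue of ultrafilters, by Zorn's lemma. If an affine [C] meets every member, adjoining [C]
    keeps the filter proper and affinely based, so maximality puts [C] in it. *)
Lemma affine_ultrafilter (K : fieldType) (V : lmodType K) (F : set_system V) :
  ProperFilter F -> affine_based F ->
  exists F' : set_system V, [/\ ProperFilter F', affine_based F', F `<=` F' &
    forall C, affine C -> (forall W, F' W -> C `&` W !=set0) -> F' C].
Proof.
move=> pF affF.
(* Imposing this on the union with [F], not on [H] alone, admits the empty chain, whose union is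
   empty. *)
pose P (H : set_system V) := ProperFilter (F `|` H) /\ affine_based (F `|` H).
have [C CP totC|H [[pH affH] maxH]] := @Zorn_bigcup _ P.
  set Q := \bigcup_(X in C) X.
  (* As the chain is total, any two members already lie in one filter below the union. *)
  have ub U W : (F `|` Q) U -> (F `|` Q) W ->
      exists H, [/\ P H, F `|` H `<=` F `|` Q, (F `|` H) U & (F `|` H) W].
    have P0 : P set0 by rewrite /P setU0.
    have PC H : C H -> P H /\ F `|` H `<=` F `|` Q.
      move=> CH; split; first exact: CP.
      by apply: setUS => X HX; exists H.
    move=> [FU|[H CH HU]] [FW|[H' CH' HW]].
    - by exists set0; rewrite setU0; split=> //; exact: subsetUl.
    - by have [? ?] := PC _ CH'; exists H'; split=> //; [left|right].
    - by have [? ?] := PC _ CH; exists H; split=> //; [right|left].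
    - have [PH sH] := PC _ CH; have [PH' sH'] := PC _ CH'.
      have [HH'|H'H] := totC _ _ CH CH'.
        by exists H'; split=> //; right=> //; exact: HH'.
      by exists H; split=> //; right=> //; exact: H'H.
  split; last first.
    move=> U QU; have [H [[_ affH] HQ HU _]] := ub _ _ QU QU.
    by have [W [HW ? ?]] := affH _ HU; exists W; split=> //; exact: HQ.
  apply: Build_ProperFilter_ex.
    move=> U QU; have [H [[pH _] _ HU _]] := ub _ _ QU QU.
    exact: (@filter_ex _ _ pH _ HU).
  split.
  - by left; exact: filterT.
  - move=> U W QU QW; have [H [[pH _] HQ HU HW]] := ub _ _ QU QW.
    by apply: HQ; exact: filterI.
  - move=> U W UW QU; have [H [[pH _] HQ HU _]] := ub _ _ QU QU.
    by apply: HQ; exact: filterS UW HU.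
exists (F `|` H); split=> //.
move=> C affC FC; apply: contrapT => nFC.
pose F' : set_system V := [set U | exists2 W, (F `|` H) W & C `&` W `<=` U].
have HF' : F `|` H `<=` F' by move=> W HW; exists W => // x [].
apply: (maxH F').
  split; first by move=> W HW; apply: HF'; right.
  move=> F'H; apply: nFC; right; apply: F'H; exists setT => [|x []//].
  exact: filterT.
rewrite /P setUidr; last by move=> U FU; apply: HF'; left.
split.
  apply: Build_ProperFilter_ex.
    by move=> U [W /FC[x CWx] CWU]; exists x; exact: CWU.
  split.
  - by exists setT => //; exact: filterT.
  - move=> U U' [W FW WU] [W' FW' WU']; exists (W `&` W'); first exact: filterI.
    by move=> x [Cx [Wx W'x]]; split; [exact: WU|exact: WU'].
  - by move=> U U' UU' [W FW WU]; exists W => //; exact: subset_trans UU'.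
move=> U [W /affH[W' [FW' affW' WW']] CWU]; exists (C `&` W'); split.
- by exists W'.
- move=> k x y z [Cx Wx] [Cy Wy] [Cz Wz].
  by split; [exact: affC|exact: affW'].
- by move=> x [Cx Wx]; apply: CWU; split=> //; exact: WW'.
Qed.

(* In a maximal affinely based filter, each coordinate is determined: the
   projections of its affine members to [A] have a least element, any point of
   which defines a cylinder that belongs to the filter by maximality. *)
Lemma affine_filter_closed_point (G : eqType) (K : fieldType) (A : vectType K)
    (F : set_system (config G A)) :
  ProperFilter F -> affine_based F ->
  exists x, forall C, closed C -> F C -> C x.
Proof.
move=> pF /(affine_ultrafilter pF)[H [pH affH FH ultraH]].
have Hx g : exists a : A, H [set y | y g = a].
  have [|W W' [HW affW] [HW' affW']|W [HW affW]|W0 [HW0 affW0] minW0] :=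
    @affine_least K A _ [set W : set (config G A) | H W /\ affine W]
      (fun W => [set y g | y in W]).
  - by have [W [HW affW _]] := affH _ filterT; exists W.
  - have [U [HU affU UW]] := affH _ (filterI HW HW').
    exists U => // _ [y /UW[Wy W'y] <-].
    by split; exists y.
  - split; last by have [y Wy] := filter_ex HW; exists (y g), y.
    move=> k _ _ _ [x Wx <-] [y Wy <-] [z Wz <-].
    by exists (k *: (x - y) + z) => //; exact: affW.
  have [y0 Wy0] := filter_ex HW0; exists (y0 g); apply: ultraH.
    move=> k x y z /= xg yg zg.
    by rewrite -[LHS]/(k *: (x g - y g) + z g) xg yg zg subrr scaler0 add0r.
  (* The projection of any affine member contains the least one, so this member meets the
     cylinder. *)
  move=> U /affH[W [HW affW WU]].
  have [y Wy yg] := minW0 W (conj HW affW) (y0 g) (imageP _ Wy0).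
  by exists y; split => //; exact: WU.
have [x {}Hx] := choice Hx.
exists x => C /closed_configP cC /FH HC; apply: cC => s.
have Hs : H [set y | agree s x y].
  elim: s => [|g s IHs]; first by apply: filterS filterT => y _ h.
  apply: filterS (filterI (Hx g) IHs) => y [/= yg ys] h.
  by rewrite inE => /predU1P[->//|]; exact: ys.
by have [y [Cy xy]] := filter_ex (filterI HC Hs); exists y.
Qed.

(** The family is a base of a proper affinely based filter. *)
Lemma closed_affine_bigcap (G : eqType) (K : fieldType) (A : vectType K)
    I (D : set I) (S : I -> set (config G A)) :
  D !=set0 -> directed D S ->
  (forall i, D i -> [/\ affine (S i), closed (S i) & S i !=set0]) ->
  \bigcap_(i in D) S i !=set0.
Proof.
move=> D0 dirS propS.
have pF : ProperFilter (filter_from D S).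
  apply: filter_from_proper; first exact: filter_from_filter.
  by move=> i /propS[].
have [|x xS] := affine_filter_closed_point pF.
  move=> U [i Di SU]; have [affi _ _] := propS _ Di.
  by exists (S i); split=> //; exists i.
exists x => i Di; apply: xS; first by have [] := propS _ Di.
by exists i.
Qed.

(** * Subspaces and affine subspaces under linear maps *)

Lemma submod_setP (K : fieldType) (V : lmodType K) (S : set V) :
  GRing.submod_closed [in S] <->
  S 0 /\ forall (k : K) x y, S x -> S y -> S (k *: x + y).
Proof.
split=> [[/= /set_mem S0 SD]|[S0 SD]].
  by split=> // k x y /mem_set Sx /mem_set Sy; exact/set_mem/SD.
split=> [|k x y /set_mem Sx /set_mem Sy]; first exact: mem_set.
by apply: mem_set; exact: SD.
Qed.

Lemma submod_affine (K : fieldType) (V : lmodType K) (S : set V) :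
  GRing.submod_closed [in S] -> affine S.
Proof.
move=> /submod_setP[_ SD] k x y z Sx Sy Sz; apply: (SD) => //.
by rewrite addrC -scaleN1r; exact: SD.
Qed.

Lemma submod_image (K : fieldType) (U V : lmodType K) (f : {linear U -> V})
    (S : set U) :
  GRing.submod_closed [in S] -> GRing.submod_closed [in f @` S].
Proof.
move=> /submod_setP[S0 SD]; apply/submod_setP; split.
  by exists 0 => //; rewrite linear0.
move=> k _ _ [x Sx <-] [y Sy <-].
by exists (k *: x + y); [exact: SD|exact: linearP].
Qed.

Lemma submod_bigcap (K : fieldType) (V : lmodType K) I (D : set I)
    (S : I -> set V) :
  (forall i, D i -> GRing.submod_closed [in S i]) ->
  GRing.submod_closed [in \bigcap_(i in D) S i].
Proof.
move=> subS; apply/submod_setP; split=> [i /subS/submod_setP[]//|].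
move=> k x y Sx Sy i Di; have /submod_setP[_] := subS i Di.
by apply; [exact: Sx|exact: Sy].
Qed.

Lemma affine_fiber (K : fieldType) (U V : lmodType K) (f : {linear U -> V}) u :
  affine [set x | f x = u].
Proof.
move=> k x y z /= fx fy fz.
by rewrite linearP linearB fx fy fz subrr scaler0 add0r.
Qed.

Lemma affineI (K : fieldType) (V : lmodType K) (S S' : set V) :
  affine S -> affine S' -> affine (S `&` S').
Proof.
by move=> aS aS' k x y z [? ?] [? ?] [? ?]; split; [exact: aS|exact: aS'].
Qed.

Lemma affine_image (K : fieldType) (U V : lmodType K) (f : {linear U -> V})
    (S : set U) : affine S -> affine (f @` S).
Proof.
move=> aS k _ _ _ [x Sx <-] [y Sy <-] [z Sz <-].
by exists (k *: (x - y) + z); [exact: aS|rewrite linearP linearB].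
Qed.

Lemma iter_is_linear (K : fieldType) (V : lmodType K) (t : {linear V -> V}) n :
  linear (iter n t).
Proof. by elim: n => [//|n IHn] k x y; rewrite !iterS IHn linearP. Qed.

HB.instance Definition _ (K : fieldType) (V : lmodType K) (t : {linear V -> V})
  n := GRing.isLinear.Build K V V *:%R (iter n t) (iter_is_linear t n).

(** * Closed images and decreasing intersections *)

Section LinearCompactness.
Variables (G : eqType) (K : fieldType) (A : vectType K).
Implicit Types (S : set (config G A)).

Definition finitary T (f : config G A -> T) :=
  exists s : seq G, forall x y, agree s x y -> f x = f y.

(** For the prodiscrete structure this is uniform continuity of [h]. *)
Definition local (h : config G A -> config G A) :=
  forall g, finitary (h^~ g).

Lemma local_agree h s : local h ->
  exists s', forall x y, agree s' x y -> agree s (h x) (h y).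
Proof.
move=> loch; elim: s => [|g s [s' IHs]]; first by exists [::] => x y _ h'.
have [s1 gs1] := loch g; exists (s1 ++ s') => x y xy h'.
have [xy1 xy2] : agree s1 x y /\ agree s' x y.
  by split=> i i1; apply: xy; rewrite mem_cat i1 ?orbT.
by rewrite inE => /predU1P[->|]; [exact: gs1|exact: IHs].
Qed.

Lemma finitary_comp T (f : config G A -> T) h :
  finitary f -> local h -> finitary (f \o h).
Proof.
move=> [s fs] /(local_agree s)[s' hs]; exists s' => x y xy.
exact/fs/hs.
Qed.

Lemma local_iter h n : local h -> local (iter n h).
Proof.
move=> loch; elim: n => [|n IHn] g.
  by exists [:: g] => x y; apply; rewrite mem_head.
exact: (finitary_comp (loch g) IHn).
Qed.

Lemma closed_fiber T (f : config G A -> T) u :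
  finitary f -> closed [set x | f x = u].
Proof.
move=> [s fs]; apply/closed_configP => x /(_ s)[y /= <-]; exact: fs.
Qed.

Lemma closed_local_fiber h u : local h -> closed [set x | h x = u].
Proof.
move=> loch; rewrite (_ : mkset _ = \bigcap_g [set x | h x g = u g]).
  by apply: closed_bigI => g _; exact: closed_fiber (loch g).
apply/seteqP; split=> x /= hx => [g _|]; first by rewrite /= hx.
exact/funext/(hx^~ I).
Qed.

(** For [y] in the closure of the image, linear compactness applies to the sets [C s] of points of
    [S] whose image agrees with [y] on [s]; a common point is a preimage of [y]. *)
Lemma closed_image (h : {linear config G A -> config G A}) S :
  local h -> affine S -> closed S -> closed (h @` S).
Proof.
move=> loch aS cS; apply/closed_configP => y hSy.
pose C s := S `&` [set x | agree s y (h x)].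
have [||s _|x Cx] := @closed_affine_bigcap G K A _ setT C.
- by exists [::].
- move=> s s' _ _; exists (s ++ s') => // x [Sx yx].
  by split; split=> // g gs; apply: yx; rewrite mem_cat gs ?orbT.
- split.
  + apply: affineI => // k x1 x2 x3 /= y1 y2 y3 g gs.
    rewrite linearP linearB.
    rewrite -[RHS]/(k *: (h x1 g - h x2 g) + h x3 g) -y1// -y2// -y3//.
    by rewrite subrr scaler0 add0r.
  + apply: closedI => //; apply/closed_configP => x Cx g gs.
    have [s' hs'] := local_agree s loch; have [z /= yz /hs' xz] := Cx s'.
    by rewrite yz// xz.
  + by have [_ [x Sx <-] yx] := hSy s; exists x.
exists x; first by have [] := Cx [::] I.
apply/funext => g; have [_ /(_ g)->//] := Cx [:: g] I.
by rewrite mem_head.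
Qed.

Variable S : nat -> set (config G A).
Hypothesis decrS : forall n, S n.+1 `<=` S n.
Hypothesis affS : forall n, affine (S n).
Hypothesis closedS : forall n, closed (S n).

Let decr_leq m n : (m <= n)%N -> S n `<=` S m.
Proof.
move=> /subnK<-; elim: (n - m)%N => [//|k IHk] x.
by rewrite addSn => /decrS/IHk.
Qed.

(** Linear compactness is applied to the traces on the [S n] of the fibre over [u]. *)
Lemma image_bigcap_decr (V : lmodType K) (f : {linear config G A -> V}) :
  (forall u, closed [set x | f x = u]) ->
  \bigcap_n (f @` S n) `<=` f @` (\bigcap_n S n).
Proof.
move=> cf u fSu.
have [||n _|x Cx] :=
  @closed_affine_bigcap G K A _ setT (fun n => S n `&` [set x | f x = u]).
- by exists 0%N.
- move=> m n _ _; exists (maxn m n) => // x [Sx fx].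
  by split; split=> //; apply: decr_leq Sx; rewrite ?leq_maxl ?leq_maxr.
- split; first by apply: affineI => //; exact: affine_fiber.
    exact: closedI.
  by have [x Sx fx] := fSu n I; exists x.
by exists x => [n _|]; [have [] := Cx n I|have [] := Cx 0%N I].
Qed.

(** Finite dimension of [V] gives a least set among the images of the [S n]; it lies in all of them,
    hence in the image of the intersection. *)
Lemma image_bigcap_stationary (V : vectType K) (f : {linear config G A -> V}) :
  finitary f -> (forall n, S n !=set0) ->
  exists n, f @` S n `<=` f @` (\bigcap_n S n).
Proof.
move=> finf S0.
have [||n _|n _ minn] := @affine_least K V _ setT (fun n => f @` S n).
- by exists 0%N.
- move=> m n _ _; exists (maxn m n) => // _ [x Sx <-].
  by split; exists x => //; apply: decr_leq Sx; rewrite ?leq_maxl ?leq_maxr.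
- by split; [exact: affine_image|have [x Sx] := S0 n; exists (f x), x].
exists n => u fu; apply: image_bigcap_decr.
  by move=> v; exact: closed_fiber.
by move=> k _; exact: minn fu.
Qed.

End LinearCompactness.

(** * Chain recurrence *)

Section Dynamics.
Variables (X : uniformType) (f : X -> X).

Lemma Per_recurrent : Per f `<=` recurrent f.
Proof.
move=> x [n n1 fx] U xU; exists n => //.
by rewrite fx; exact: nbhs_singleton.
Qed.

Lemma recurrent_nonwandering : recurrent f `<=` nonwandering f.
Proof.
move=> x xR U xU; have [n n1 Ufx] := xR U xU; exists n => //.
by exists (iter n f x); split=> //; exists x => //; exact: nbhs_singleton.
Qed.

Hypothesis unif_f : unif_continuous f.

(** Take [y] near [x] whose [n]-th iterate is near [x], and replace both ends of this orbit segment
    by [x]. *)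
Lemma nonwandering_chain_recurrent : nonwandering f `<=` chain_recurrent f.
Proof.
move=> x xNW E entE; have [E' entE' E'E] := entourage_split_ex entE.
have entV := unif_f entE'.
have [|n n1 [_ [[y [/xsectionP yV _] <-] [_ /xsectionP yx]]]] :=
  xNW (xsection [set p | E' (f p.1, f p.2)] x `&` xsection E'^-1%relation x).
  by apply: filterI; apply: nbhs_entourage => //; exact: entourage_inv.
exists n, (fun i => if (i == 0%N) || (i == n) then x else iter i f y).
rewrite eqxx eqxx orbT; split=> // i lt_in; apply: E'E.
(* The error before this point occurs only for [i = 0], the one after it only for [i.+1 = n]; for
   [n = 1] both occur at once. *)
exists (iter i.+1 f y) => /=.
  rewrite (ltn_eqF lt_in) orbF; case: eqP => [->//|_].
  exact: entourage_refl.
case: eqP => [in_|_]; last exact: entourage_refl.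
by move: yx; rewrite -in_.
Qed.

(** Uniform continuity carries the error of the first [m] steps through [f]; splitting [E] leaves
    room for the last jump. *)
Lemma pseudo_orbit_shadow m E : entourage E ->
  exists2 E', entourage E' & forall c : nat -> X,
    (forall i, (i < m)%N -> E' (f (c i), c i.+1)) -> E (iter m f (c 0%N), c m).
Proof.
elim: m E => [|m IHm] E entE.
  by exists E => // c _; exact: entourage_refl.
have [E' entE' E'E] := entourage_split_ex entE.
have [V entV mV] := IHm _ (unif_f entE').
exists (V `&` E'); first exact: filterI.
move=> c cE; apply: E'E; exists (f (c m)) => /=.
  by apply: (mV c) => i im; have [] := cE i (ltnW im).
by have [] := cE m (ltnSn m).
Qed.

Lemma chain_recurrent_iter x : chain_recurrent f x ->
  forall m E, entourage E -> exists y, E (iter m f y, x).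
Proof.
move=> xCR m E /(pseudo_orbit_shadow m)[E' /xCR[n [c [n1 c0 cn cE]]] mE].
(* Walking [m] steps round the closed chain from an index congruent to [-m] modulo [n] ends at
   [c 0 = x]. *)
exists (c ((m * n - m) %% n)%N).
have := mE (fun i => c ((m * n - m + i) %% n)%N).
rewrite addn0 subnK ?leq_pmulr// modnMl c0; apply=> i _.
rewrite addnS -[(_ + i).+1]addn1 -(modnDml (_ + i)%N) addn1.
have := ltn_pmod (m * n - m + i) n1; set j := (_ %% n)%N => jn.
have := cE j jn.
(* After index [n - 1] the walk wraps around, since [c n = x = c 0]. *)
move: jn; rewrite leq_eqVlt => /predU1P[->|jn]; last by rewrite modn_small.
by rewrite modnn cn c0.
Qed.

End Dynamics.

(* If [b = N t(b)] then [b = N^k t^k(b)], so the characteristic polynomial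
   [\sum_k p_k X^k] of [N] gives [\sum_k p_k t^(n-k) = 0] on the span of [b]. *)
Lemma surjective_annihilator (K : fieldType) (V : lmodType K)
    (t : {linear V -> V}) (W : set V) :
  finite_dimensional W -> W `<=` t @` W ->
  exists m (a : nat -> K), a m = 1 /\
    forall x, W x -> \sum_(k < m.+1) a k *: iter (m - k) t x = 0.
Proof.
move=> [[|n] [b ->]] surjW.
  exists 0%N, (fun=> 1); split=> // _ [c _ <-].
  by rewrite big_ord_recl !big_ord0 scale1r addr0.
have /choice[N bN] j : exists c : 'I_n.+1 -> K, b j = \sum_i c i *: t (b i).
  have [_ [c _ <-] tc] : (t @` range
      (fun c : 'I_n.+1 -> K => \sum_(i < n.+1) c i *: b i)) (b j).
    apply: surjW; exists (fun i => (i == j)%:R) => //.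
    rewrite (bigD1 j)//= eqxx scale1r big1 ?addr0// => i /negPf->.
    by rewrite scale0r.
  by exists c; rewrite -tc linear_sum; apply: eq_bigr => i _; rewrite linearZ.
pose M : 'M[K]_n.+1 := \matrix_(j, i) N j i.
have bM k j : b j = \sum_i (M ^+ k) j i *: iter k t (b i).
  elim: k j => [|k IHk] j.
    rewrite (bigD1 j)//= expr0 mxE eqxx scale1r big1 ?addr0// => i ij.
    by rewrite mxE eq_sym (negPf ij) scale0r.
  rewrite bN exprS.
  under [RHS]eq_bigr do rewrite mxE scaler_suml.
  rewrite exchange_big; apply: eq_bigr => i _.
  rewrite {1}(IHk i) linear_sum scaler_sumr; apply: eq_bigr => l _.
  by rewrite linearZ scalerA mxE iterS.
pose p := char_poly M.
have pM : \sum_(k < n.+2) p`_k *: M ^+ k = 0.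
  rewrite -[RHS](Cayley_Hamilton M) -/p -[p in RHS]coefK poly_def.
  rewrite size_char_poly linear_sum; apply: eq_bigr => k _.
  by rewrite linearZ rmorphXn/= horner_mx_X.
exists n.+1, (fun k => p`_k); split.
  have /monicP := char_poly_monic M.
  by rewrite lead_coefE size_char_poly.
have pb j : \sum_(k < n.+2) p`_k *: iter (n.+1 - k) t (b j) = 0.
  (* Expanding [b j] with the entries of [M ^+ k] in the [k]-th term leaves [iter n.+1 t] in every
     term. *)
  transitivity (\sum_i (\sum_(k < n.+2) p`_k *: M ^+ k) j i
                  *: iter n.+1 t (b i)); last first.
    by rewrite pM big1// => i _; rewrite mxE scale0r.
  under [RHS]eq_bigr do rewrite summxE scaler_suml.
  rewrite exchange_big; apply: eq_bigr => k _.
  rewrite {1}(bM k j) linear_sum scaler_sumr; apply: eq_bigr => i _.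
  by rewrite linearZ/= -iterD subnK ?scalerA ?mxE// -ltnS.
move=> _ [c _ <-]; under eq_bigr do rewrite linear_sum scaler_sumr.
rewrite exchange_big big1// => i _.
under eq_bigr do rewrite linearZ/= scalerA mulrC -scalerA.
by rewrite -scaler_sumr pb scaler0.
Qed.

(** * Limit sets of linear cellular automata *)

Lemma config_sumE (G : Type) (K : fieldType) (A : lmodType K) I (r : seq I)
    (P : pred I) (F : I -> config G A) g :
  (\sum_(i <- r | P i) F i) g = \sum_(i <- r | P i) F i g.
Proof. exact: (big_morph (fun x : config G A => x g)). Qed.

Section LinearCA.
Variables (G : groupType) (K : fieldType) (A : vectType K).
Variable t : config G A -> config G A.
Hypothesis CA_t : linear_CA t.

Lemma linear_CA_linear : linear t.
Proof.
have [M [_ [mu tE]]] := CA_t => k x y; apply/funext => g.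
by rewrite tE -[RHS]/(k *: t x g + t y g) !tE -linearP.
Qed.

Lemma linear_CA_local : local t.
Proof.
have [M [/finite_seqP[s ->] [mu tE]]] := CA_t => g.
exists [seq (g * h)%g | h <- s] => x y xy; rewrite !tE; congr (mu _).
apply/funext => h; rewrite /restr /shift invgK.
by apply: xy; apply: map_f; exact: set_mem (valP h).
Qed.

Lemma linear_CA_shift g x : t (shift g x) = shift g (t x).
Proof.
have [M [_ [mu tE]]] := CA_t; apply/funext => h.
rewrite -[RHS]/(t x (g^-1 * h)%g) !tE; congr (mu _); apply/funext => m.
by rewrite /restr /shift !invgK mulgA.
Qed.

End LinearCA.

(** * The limit set inside the full configuration space *)

Section LimitSet.
Variables (G : groupType) (K : fieldType) (A : vectType K).
Variables (Sigma : set (config G A)) (t : {linear config G A -> config G A}).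
Hypothesis subshift_Sigma : linear_subshift Sigma.
Hypothesis local_t : local t.
Hypothesis shift_t : forall g x, t (shift g x) = shift g (t x).
Hypothesis stab_t : forall x, Sigma x -> Sigma (t x).

Definition orbit_image n := iter n t @` Sigma.
(** The index starts at 0, unlike in [limit_set]; under [stab_t] the images decrease, so the
    intersection is the same. *)
Definition omega := \bigcap_n orbit_image n.

Lemma orbit_image0 : orbit_image 0 = Sigma.
Proof. exact: image_id. Qed.

Lemma orbit_imageS n : orbit_image n.+1 = t @` orbit_image n.
Proof. by rewrite /orbit_image image_comp. Qed.

Lemma orbit_image_decr n : orbit_image n.+1 `<=` orbit_image n.
Proof.
move=> _ [x Sx <-]; exists (t x); first exact: stab_t.
by rewrite iterSr.
Qed.

Lemma orbit_image_submod n : GRing.submod_closed [in orbit_image n].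
Proof.
have [_ _ subS] := subshift_Sigma.
exact: (submod_image (iter n t) subS).
Qed.

Lemma orbit_image_affine n : affine (orbit_image n).
Proof. exact: submod_affine (@orbit_image_submod n). Qed.

Lemma orbit_image_nonempty n : orbit_image n !=set0.
Proof. by have /submod_setP[S0 _] := orbit_image_submod n; exists 0. Qed.

Lemma orbit_image_closed n : closed (orbit_image n).
Proof.
have [cS _ _] := subshift_Sigma; rewrite -orbit_image0 in cS.
elim: n => [//|n IHn]; rewrite orbit_imageS.
by apply: closed_image => //; exact: orbit_image_affine.
Qed.

Lemma shift_iter n g x : iter n t (shift g x) = shift g (iter n t x).
Proof. by elim: n => //= n ->; rewrite shift_t. Qed.

Lemma orbit_image_shift n g x : orbit_image n x -> orbit_image n (shift g x).
Proof.
have [_ shS _] := subshift_Sigma => -[y Sy <-].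
by exists (shift g y); [exact: shS|rewrite shift_iter].
Qed.

Lemma omega_subshift : linear_subshift omega.
Proof.
split.
- by apply: closed_bigI => n _; exact: orbit_image_closed.
- by move=> g x Ox n _; apply: orbit_image_shift; exact: Ox.
- by apply: submod_bigcap => n _; exact: orbit_image_submod.
Qed.

(** Linear compactness gives the inclusion of [omega] in its image, the fibres of [t] being
    closed. *)
Lemma omega_image : t @` omega = omega.
Proof.
apply/seteqP; split=> [_ [x Ox <-] n _|x Ox].
  by apply: orbit_image_decr; rewrite orbit_imageS; exists x => //; exact: Ox.
apply: image_bigcap_decr.
- exact: orbit_image_decr.
- exact: orbit_image_affine.
- exact: orbit_image_closed.
- by move=> u; exact: closed_local_fiber.
- by move=> n _; rewrite -orbit_imageS; exact: Ox.
Qed.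

Lemma orbit_image_stationary (V : vectType K) (f : {linear config G A -> V}) :
  finitary f -> exists n, f @` orbit_image n `<=` f @` omega.
Proof.
move=> finf; apply: image_bigcap_stationary => //.
- exact: orbit_image_decr.
- exact: orbit_image_affine.
- exact: orbit_image_closed.
- exact: orbit_image_nonempty.
Qed.

(** For some [n], patterns of [orbit_image n] on the defining window all occur in [omega]. By shift
    invariance this holds at every translate, so [orbit_image n] lies in [omega]. *)
Lemma omega_SFT_stationary :
  linear_SFT omega -> exists n, orbit_image n `<=` orbit_image n.+1.
Proof.
move=> [_ [D [/finite_seqP[s ->] [P omegaE]]]].
(* Indexing the window by an ordinal makes the target a finite-dimensional space. *)
pose f (x : config G A) : {ffun 'I_(size s) -> A} :=
  [ffun i : 'I_(size s) => x (nth 1%g s i)].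
have linf : linear f by move=> k x y; apply/ffunP => i; rewrite !ffunE.
pose fL : {linear config G A -> {ffun 'I_(size s) -> A}} :=
  HB.pack f (GRing.isLinear.Build K _ _ _ f linf).
have [|n fn] := @orbit_image_stationary _ fL.
  exists s => x y xy; apply/ffunP => i; rewrite !ffunE.
  by apply: xy; exact: mem_nth.
exists n => x nx; suff : omega x by apply.
rewrite omegaE => g.
have [y Oy fy] := fn _ (imageP _ (orbit_image_shift g^-1%g nx)).
suff -> : @restr _ _ _ [set` s] (shift g^-1%g x) = restr (shift 1%g y).
  by move: Oy; rewrite omegaE -invg1; apply.
apply/funext => h; have hs : set_val h \in s := set_mem (valP h).
rewrite /restr {2}/shift invg1 mul1g.
have /ffunP/(_ (Ordinal (etrans (index_mem _ s) hs))) := fy.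
by rewrite !ffunE /= nth_index.
Qed.

(** The value of [q x] at the identity is finitary and vanishes on [omega], hence on some
    [orbit_image n]; shift invariance extends this to all coordinates. *)
Lemma omega_finite_dimensional_stationary :
  finite_dimensional omega -> exists n, orbit_image n `<=` orbit_image n.+1.
Proof.
move=> fdO; have [|m [a [am1 aO]]] := surjective_annihilator fdO (t := t).
  by rewrite omega_image.
pose q x := \sum_(k < m.+1) a k *: iter (m - k) t x.
have q_shift g x : q (shift g x) = shift g (q x).
  rewrite /q; under eq_bigr do rewrite shift_iter.
  by apply/funext => h; rewrite {2}/shift !config_sumE.
pose f x : A := q x 1%g.
have linf : linear f.
  move=> k x y; rewrite -[RHS]/((k *: q x + q y) 1%g); congr (_ 1%g).
  rewrite /q scaler_sumr -big_split; apply: eq_bigr => i _ /=.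
  by rewrite linearP scalerDr !scalerA mulrC.
pose fL : {linear config G A -> A} :=
  HB.pack f (GRing.isLinear.Build K _ _ _ f linf).
have [|n fn] := @orbit_image_stationary _ fL.
  have [s sm] : exists s, forall x y, agree s x y ->
      forall k, (k <= m)%N -> iter k t x 1%g = iter k t y 1%g.
    elim: (m) => [|k [s sk]].
      exists [:: 1%g] => x y xy k; rewrite leqn0 => /eqP->.
      exact/xy/mem_head.
    have [s' s'k] := local_iter k.+1 local_t 1%g.
    exists (s ++ s') => x y xy l; rewrite leq_eqVlt => /predU1P[->|].
      by apply: s'k => g gs; apply: xy; rewrite mem_cat gs orbT.
    by apply: sk => g gs; apply: xy; rewrite mem_cat gs.
  exists s => x y xy; rewrite /= /f /q !config_sumE; apply: eq_bigr => k _.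
  by congr (_ *: _); apply: sm => //; exact: leq_subr.
have q0 x : orbit_image n x -> q x = 0.
  move=> nx; apply/funext => g.
  have [y Oy fy] := fn _ (imageP _ (orbit_image_shift g^-1%g nx)).
  move: fy; rewrite /= /f q_shift /shift invgK mulg1 => <-.
  by rewrite [q y]aO.
(* As [a m = 1], the relation [q (iter n t x) = 0] expresses [iter n t x] through iterates of order
   at least [n.+1]. *)
exists n => _ [x Sx <-].
have /submod_setP[O0 OD] := orbit_image_submod n.+1.
have := q0 _ (imageP _ Sx); rewrite /q big_ord_recr /= subnn /= am1 scale1r.
move=> /eqP; rewrite addrC addr_eq0 => /eqP->; rewrite -scaleN1r -[_ *: _]addr0.
apply: (OD) => //; elim/big_ind: _ => //.
  by move=> y z Oy Oz; rewrite -[y]scale1r; exact: OD.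
move=> k _; rewrite -[_ *: _]addr0; apply: (OD) => //.
have /prednK <- : (0 < m - k)%N by rewrite subn_gt0.
rewrite -iterD addnC addnS -addSn iterD; exists (iter (m - k).-1 t x) => //.
by elim: (_.-1) => //= j; exact: stab_t.
Qed.

End LimitSet.

(** * Transfer to the restricted map [tau] *)

Section Restriction.
Variables (G : groupType) (K : fieldType) (A : vectType K).
Variables (Sigma : set (config G A)) (t : {linear config G A -> config G A}).
Variable tau : Sigma -> Sigma.
Hypothesis subshift_Sigma : linear_subshift Sigma.
Hypothesis local_t : local t.
Hypothesis tauE : forall x, set_val (tau x) = t (set_val x).

Lemma restriction_stable x : Sigma x -> Sigma (t x).
Proof.
by move=> /mem_set Sx; rewrite -(tauE (SigSub Sx)); exact: set_mem (valP _).
Qed.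

Lemma set_val_iter n x : set_val (iter n tau x) = iter n t (set_val x).
Proof. by elim: n => //= n <-; rewrite tauE. Qed.

Lemma range_iterE n x :
  range (iter n tau) x <-> orbit_image Sigma t n (set_val x).
Proof.
split=> [[y _ <-]|[y /mem_set Sy yx]].
  by exists (set_val y); [exact: set_mem (valP y)|rewrite set_val_iter].
exists (SigSub Sy) => //; apply: val_inj.
by rewrite -[RHS]yx [LHS]set_val_iter.
Qed.

Lemma limit_setE x : limit_set tau x <-> omega Sigma t (set_val x).
Proof.
split=> Ox n _; last by apply/range_iterE; exact: Ox.
apply: orbit_image_decr; first exact: restriction_stable.
by apply/range_iterE; exact: Ox.
Qed.

Lemma set_val_limit_set : set_val @` limit_set tau = omega Sigma t.
Proof.
apply/seteqP; split=> [_ [x /limit_setE Ox <-]//|x Ox].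
have /mem_set Sx : Sigma x by rewrite -(orbit_image0 Sigma t); exact: Ox.
by exists (SigSub Sx) => //; apply/limit_setE.
Qed.

Lemma orbit_image_stable n :
  orbit_image Sigma t n `<=` orbit_image Sigma t n.+1 -> stable tau.
Proof.
(* A positive exponent is required, while stationarity may start at [n = 0]. *)
move=> nS; exists n.+1 => //; apply/seteqP; split=> x /range_iterE Wx.
  by apply/range_iterE; apply: orbit_image_decr Wx; exact: restriction_stable.
apply/range_iterE; rewrite orbit_imageS.
by move: Wx; rewrite {1}orbit_imageS => -[y /nS Wy <-]; exists y.
Qed.

Lemma restriction_unif_continuous : unif_continuous tau.
Proof.
move=> E /set_type_entourageP[s sE].
have [s' s's] := local_agree s local_t; apply/set_type_entourageP; exists s'.
by move=> p /s's ps; apply: sE; rewrite /= !tauE.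
Qed.

(** Following pseudo-orbits for [n] steps makes [x] a limit of points of the closed set
    [orbit_image n]. *)
Lemma chain_recurrent_limit_set : chain_recurrent tau `<=` limit_set tau.
Proof.
move=> x xCR n _; apply/range_iterE.
have /closed_configP := @orbit_image_closed _ _ _ _ t subshift_Sigma local_t n.
apply=> s.
have [|y xy] := chain_recurrent_iter restriction_unif_continuous xCR n
  (E := [set p | agree s (set_val p.2) (set_val p.1)]).
  by apply/set_type_entourageP; exists s => p ps g /ps.
by exists (set_val (iter n tau y)) => //; apply/range_iterE; exists y.
Qed.

End Restriction.

Theorem corollary1p6 (G : groupType) (K : fieldType) (A : vectType K)
    (Sigma : set (config G A)) (tau : Sigma -> Sigma)
    (sofic_Sigma : linear_sofic Sigma) (CA_tau : linear_CA_on tau) :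
  linear_subshift (set_val @` limit_set tau) /\
  tau @` limit_set tau = limit_set tau /\
  (Per tau `<=` recurrent tau /\
   recurrent tau `<=` nonwandering tau /\
   nonwandering tau `<=` chain_recurrent tau /\
   chain_recurrent tau `<=` limit_set tau) /\
  (linear_SFT (set_val @` limit_set tau) -> stable tau) /\
  (finite_dimensional (set_val @` limit_set tau) -> stable tau).
Proof.
have [subS _] := sofic_Sigma; have [t0 CA_t tauE] := CA_tau.
pose t : {linear config G A -> config G A} :=
  HB.pack t0 (GRing.isLinear.Build K _ _ _ t0 (linear_CA_linear CA_t)).
have loct : local t := linear_CA_local CA_t.
have shift_t g x : t (shift g x) = shift g (t x) := linear_CA_shift CA_t g x.
have {}tauE x : set_val (tau x) = t (set_val x) := tauE x.
have stabt := restriction_stable tauE.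
rewrite (set_val_limit_set tauE).
split; first exact: omega_subshift.
split.
  apply/seteqP; split=> [_ [x /(limit_setE tauE) Ox <-]|x /(limit_setE tauE)].
    apply/(limit_setE tauE); rewrite -omega_image// tauE.
    by exists (set_val x).
  (* The preimage under [t] is taken inside [omega], hence comes from a point of the limit set of
     [tau]. *)
  rewrite -{1}omega_image// -(set_val_limit_set tauE).
  move=> [_ [y Oy <-] yx]; exists y => //.
  by apply: val_inj; rewrite -[RHS]yx [LHS]tauE.
split.
  split; first exact: Per_recurrent.
  split; first exact: recurrent_nonwandering.
  split; last exact: chain_recurrent_limit_set tauE.
  apply: nonwandering_chain_recurrent.
  exact: restriction_unif_continuous tauE.
split=> [sftO|fdO].
  have [n nS] := omega_SFT_stationary subS loct shift_t stabt sftO.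
  exact (orbit_image_stable tauE nS).
have [n nS] :=
  omega_finite_dimensional_stationary subS loct shift_t stabt fdO.
exact (orbit_image_stable tauE nS).
Qed.
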